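(* Let $k$ be a positive integer and consider the $k$-th order system of two rational difference equations $$x_n=\frac{\alpha+\sum^{k}_{i=1}\beta_{i}x_{n-i} + \sum^{k}_{i=1}\gamma_{i}y_{n-i}}{A+\sum^{k}_{j=1}B_{j}x_{n-j} + \sum^{k}_{j=1}C_{j}y_{n-j}},\qquad y_n=\frac{p+\sum^{k}_{i=1}\delta_{i}x_{n-i} + \sum^{k}_{i=1}\epsilon_{i}y_{n-i}}{q+\sum^{k}_{j=1}D_{j}x_{n-j} + \sum^{k}_{j=1}E_{j}y_{n-j}},\qquad n\in\mathbb{N},$$ with non-negative real parameters and non-negative initial conditions. Assume that there exist $M_1,M_3>0$ and $M_4\ge M_2\ge 0$ such that every solution satisfies $x_n\le M_1y_n+M_2\le M_3x_n+M_4$ for all $n\in\mathbb{N}$. Suppose that $A>0$ and that there exists a positive integer $\eta$ such that for every sequence $\{c_m\}_{m=1}^\infty$ with $c_m\in I_\beta\cup I_\gamma$ for all $m\ge 1$ there exist positive integers $N_1,N_2\le\eta$ such that $\sum_{m=N_1}^{N_2}c_m\in I_B\cup I_C$. Then there exist $M>0$ and $N\in\mathbb{N}$ such that every solution (from any non-negative initial conditions) satisfies $x_n\le M$ and $y_n\le M$ for all $n>N$.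
   Context: $\mathbb{N}=\{1,2,\dots\}$. Initial conditions are $x_{1-k},\dots,x_0,y_{1-k},\dots,y_0\ge 0$; a solution is a pair of sequences generated by the system from non-negative initial conditions for which all denominators are positive for every $n\in\mathbb{N}$. Index sets in $\{1,\dots,k\}$: $I_\beta=\{i:\beta_i>0\}$, $I_\gamma=\{i:\gamma_i>0\}$, $I_B=\{j:B_j>0\}$, $I_C=\{j:C_j>0\}$. A sum $\sum_{m=N_1}^{N_2}$ with $N_1>N_2$ is empty and equals $0$. *)

(* Defs.v *)
From mathcomp Require Import all_boot all_order all_algebra.
From mathcomp Require Import all_reals.

Set Implicit Arguments.
Unset Strict Implicit.
Unset Printing Implicit Defensive.

Import Order.TTheory GRing.Theory Num.Theory.
Local Open Scope ring_scope.

(* Coefficient families b : nat -> R are indexed from 1: only b 1, ..., b k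
   are relevant.  Sequences x : int -> R are indexed by all integers because
   the initial conditions sit at 1 - k, ..., 0; values at indices below 1 - k
   are junk and are never read. *)

Definition affine_form (R : realType) (k : nat) (a : R) (b c : nat -> R)
    (x y : int -> R) (n : nat) : R :=
  a + \sum_(1 <= i < k.+1) b i * x (n%:Z - i%:Z)
    + \sum_(1 <= i < k.+1) c i * y (n%:Z - i%:Z).

Definition is_solution (R : realType) (k : nat)
    (alpha : R) (beta gamma : nat -> R) (A : R) (B C : nat -> R)
    (p : R) (delta epsilon : nat -> R) (q : R) (D E : nat -> R)
    (x y : int -> R) : Prop :=
  (forall m : int, 1 - k%:Z <= m <= 0 -> 0 <= x m /\ 0 <= y m) /\
  (forall n : nat, (1 <= n)%N ->
     [/\ 0 < affine_form k A B C x y n,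
         0 < affine_form k q D E x y n,
         x n%:Z = affine_form k alpha beta gamma x y n
                    / affine_form k A B C x y n
       & y n%:Z = affine_form k p delta epsilon x y n
                    / affine_form k q D E x y n]).

Definition nonneg_coeffs (R : realType) (k : nat) (b : nat -> R) : Prop :=
  forall i : nat, (1 <= i <= k)%N -> 0 <= b i.

Definition pos_index (R : realType) (k : nat) (b : nat -> R) : pred nat :=
  [pred i : nat | (1 <= i <= k)%N && (0 < b i)].

(* Main.v *)
(* Comparability bounds y_n by an affine function of x_n, so that, since A > 0,
   x_n <= f (x_{n-i}) for an increasing affine f and the i in I_beta U I_gamma
   that maximises x_{n-i}.  Following these maximisers backwards from n gives a
   path n = t_0 > t_1 > ...; the hypothesis on index sequences, applied to its
   steps, yields t = t_a with a < eta such that t - j is a later point of the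
   path, within eta + 1 steps, for some j in I_B U I_C.  The numerator of x_t is
   then at most affine in x_{t-j} while its denominator grows at least linearly
   in x_{t-j} or y_{t-j}, so x_t is bounded by a constant T independent of the
   solution, and x_n <= f^eta (T). *)

Require Import Defs.
From mathcomp Require Import all_boot all_order all_algebra.
From mathcomp Require Import all_reals.

From mathcomp Require Import ring lra zify.

Set Implicit Arguments.
Unset Strict Implicit.
Unset Printing Implicit Defensive.

Import Order.TTheory GRing.Theory Num.Theory.
Local Open Scope ring_scope.

(** * Affine forms, the sign of solutions, and positive coefficients *)

Lemma affine_form_ge_term (R : realType) (k : nat) (a : R) (b c : nat -> R)
    (x y : int -> R) (n j : nat) :
  nonneg_coeffs k b -> nonneg_coeffs k c ->
  (forall i : nat, (1 <= i <= k)%N ->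
     0 <= x (n%:Z - i%:Z) /\ 0 <= y (n%:Z - i%:Z)) ->
  (1 <= j <= k)%N ->
  a + b j * x (n%:Z - j%:Z) + c j * y (n%:Z - j%:Z)
    <= affine_form k a b c x y n.
Proof.
move=> b0 c0 xy0 jk; have jin : j \in index_iota 1 k.+1.
  by rewrite mem_index_iota ltnS.
rewrite /affine_form (bigD1_seq j) ?iota_uniq //=.
rewrite (bigD1_seq j jin) ?iota_uniq //=.
have s0 (d : nat -> R) (u : int -> R) : nonneg_coeffs k d ->
    (forall i : nat, (1 <= i <= k)%N -> 0 <= u (n%:Z - i%:Z)) ->
    0 <= \sum_(1 <= i < k.+1 | i != j) d i * u (n%:Z - i%:Z).
  move=> d0 u0; rewrite big_seq_cond sumr_ge0 // => i /andP[+ _].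
  by rewrite mem_index_iota ltnS => ik; rewrite mulr_ge0 ?d0 ?u0.
have := s0 b x b0 (fun i ik => (xy0 i ik).1).
have := s0 c y c0 (fun i ik => (xy0 i ik).2).
lra.
Qed.

(** Terms with zero coefficient vanish, so [x <= z] is only needed at lags with a positive
    coefficient; each [y] term is first traded for [s * x + r]. *)
Lemma affine_form_le (R : realType) (k : nat) (a r s z : R) (b c : nat -> R)
    (x y : int -> R) (n : nat) :
  nonneg_coeffs k b -> nonneg_coeffs k c -> 0 <= r -> 0 <= s -> 0 <= z ->
  (forall i : nat, (1 <= i <= k)%N ->
     y (n%:Z - i%:Z) <= s * x (n%:Z - i%:Z) + r) ->
  (forall i : nat, i \in [predU pos_index k b & pos_index k c] ->
     x (n%:Z - i%:Z) <= z) ->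
  affine_form k a b c x y n
    <= (a + r * \sum_(1 <= i < k.+1) c i)
       + (\sum_(1 <= i < k.+1) b i + s * \sum_(1 <= i < k.+1) c i) * z.
Proof.
move=> b0 c0 r0 s0 z0 yx xz.
have -> : (a + r * \sum_(1 <= i < k.+1) c i)
       + (\sum_(1 <= i < k.+1) b i + s * \sum_(1 <= i < k.+1) c i) * z
    = a + \sum_(1 <= i < k.+1) b i * z + \sum_(1 <= i < k.+1) c i * (s * z + r).
  by rewrite -!mulr_suml; ring.
rewrite /affine_form -!addrA lerD2l; apply: lerD; rewrite !big_seq;
  apply: ler_sum => i; rewrite mem_index_iota ltnS => ik.
  have [bi|bi] := ltP 0 (b i).
    by rewrite ler_pM2l // xz // !inE ik bi.
  by have -> : b i = 0; [apply/le_anti; rewrite bi b0 | rewrite !mul0r].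
have [ci|ci] := ltP 0 (c i); last first.
  by have -> : c i = 0; [apply/le_anti; rewrite ci c0 | rewrite !mul0r].
rewrite ler_pM2l //; apply: le_trans (yx _ ik) _.
by rewrite lerD2r ler_wpM2l // xz // !inE ik ci orbT.
Qed.

Lemma solution_ge0 (R : realType) (k : nat)
    (alpha : R) (beta gamma : nat -> R) (A : R) (B C : nat -> R)
    (p : R) (delta epsilon : nat -> R) (q : R) (D E : nat -> R)
    (x y : int -> R) :
  (1 <= k)%N ->
  0 <= alpha -> nonneg_coeffs k beta -> nonneg_coeffs k gamma ->
  0 <= p -> nonneg_coeffs k delta -> nonneg_coeffs k epsilon ->
  is_solution k alpha beta gamma A B C p delta epsilon q D E x y ->
  forall m : int, 1 - k%:Z <= m -> 0 <= x m /\ 0 <= y m.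
Proof.
move=> k1 halpha hbeta hgamma hp hdelta hepsilon [hinit hrec].
suff H (n : nat) (m : int) : 1 - k%:Z <= m <= n%:Z -> 0 <= x m /\ 0 <= y m.
  by move=> m hm; apply: (H `|m|%N); lia.
elim: n m => [|n IH] m; first exact: hinit.
move=> mb; have [->|mn] := eqVneq m n.+1%:Z; last by apply: IH; lia.
have hist i : (1 <= i <= k)%N ->
    0 <= x (n.+1%:Z - i%:Z) /\ 0 <= y (n.+1%:Z - i%:Z).
  by move=> ik; apply: IH; lia.
have [d1 d2 -> ->] := hrec n.+1 isT.
(* Any lag would do: keeping the constant and the terms of one lag already shows that a numerator is
   non-negative. *)
have one_k : (1 <= 1 <= k)%N by rewrite k1.
have [x1 y1] := hist _ one_k.
split; apply: divr_ge0; (try exact: ltW);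
  apply: le_trans (affine_form_ge_term _ _ _ hist one_k) => //.
  by rewrite !addr_ge0 ?mulr_ge0 ?hbeta ?hgamma.
by rewrite !addr_ge0 ?mulr_ge0 ?hdelta ?hepsilon.
Qed.

(** Provides one constant for all positive coefficients, so that the bound [T] will not depend on
    which lag the path yields. *)
Lemma pos_index_lower_bound (R : realType) (k : nat) (b : nat -> R) :
  exists2 e : R, 0 < e & forall j, j \in pos_index k b -> e <= b j.
Proof.
elim: k => [|k [e e_gt0 he]].
  by exists 1 => // j; rewrite inE => /andP[/andP[j1 j0]]; lia.
have e_le j : j != k.+1 -> j \in pos_index k.+1 b -> e <= b j.
  move=> jk; rewrite inE => /andP[j1k bj].
  by apply: he; rewrite inE bj andbT; lia.
have [bk|bk] := ltP 0 (b k.+1).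
  exists (Num.min e (b k.+1)); first by rewrite lt_min e_gt0.
  by move=> j jin; rewrite ge_min; have [->|/e_le->//] := eqVneq j k.+1; rewrite lexx orbT.
exists e => // j jin; have [jk|/e_le->//] := eqVneq j k.+1.
by move: jin; rewrite inE jk => /andP[_]; rewrite ltNge bk.
Qed.

(** * Iterating an increasing expansive map along a descending path *)

Lemma iter_affine (R : realType) (K L : R) (m : nat) : 0 <= K -> 0 <= L ->
  exists P Q : R, [/\ 0 <= P, 0 <= Q &
    forall z, iter m (fun u => K + L * u) z = P + Q * z].
Proof.
move=> K0 L0; elim: m => [|m [P [Q [P0 Q0 IH]]]].
  by exists 0, 1; split=> // z; rewrite add0r mul1r.
exists (K + L * P), (L * Q); split; rewrite ?addr_ge0 ?mulr_ge0 // => z.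
by rewrite iterS IH mulrDr addrA mulrA.
Qed.

Lemma iter_homo_le (R : realType) (f : R -> R) (m : nat) :
  {homo f : u v / u <= v} -> {homo iter m f : u v / u <= v}.
Proof. by move=> hf u v uv; elim: m => //= m; apply: hf. Qed.

Lemma iter_expansive_le (R : realType) (f : R -> R) (m d : nat) (u : R) :
  (forall v, 0 <= v -> v <= f v) -> 0 <= u -> (m <= d)%N ->
  iter m f u <= iter d f u.
Proof.
move=> hf u0; have it0 l : 0 <= iter l f u.
  by elim: l => //= l IH; apply: le_trans IH (hf _ IH).
elim: d => [|d IH]; first by rewrite leqn0 => /eqP->.
rewrite leq_eqVlt => /predU1P[->//|]; rewrite ltnS => /IH /le_trans; apply.
exact: hf.
Qed.

Lemma descent_path_bound (R : realType) (k eta : nat) (J : pred nat)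
    (f : R -> R) (T : R) (X : nat -> R) (s : nat -> nat) :
  {homo f : u v / u <= v} -> (forall u, 0 <= u -> u <= f u) ->
  0 <= T -> (forall n, 0 <= X n) -> (forall n, (s n <= k)%N) ->
  (forall j, j \in J -> (0 < j)%N) ->
  (forall n, (k < n)%N -> X n <= f (X (n - s n)%N)) ->
  (forall n j, (k < n)%N -> j \in J ->
     X (n - s n)%N <= iter eta f (X (n - j)%N) -> X n <= T) ->
  (forall n, exists N1 N2 : nat,
     [/\ (1 <= N1 <= eta)%N, (1 <= N2 <= eta)%N &
       (\sum_(N1 <= m < N2.+1) s (iter m.-1 (fun t => t - s t) n))%N \in J]) ->
  forall n, (k * eta.+1 < n)%N -> X n <= iter eta f T.
Proof.
move=> f_homo f_exp T0 X0 sk Jpos step jump path n hn.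
pose t m := iter m (fun t => (t - s t)%N) n.
have tS m : t m.+1 = (t m - s (t m))%N by [].
(* Each step lowers the index by at most [k], so starting above [k * eta.+1] keeps [t m] above [k]
   for all [m <= eta]. Along this range the truncated subtraction is therefore genuine. *)
have t_ge m : (n <= t m + k * m)%N.
  elim: m => [|m IH]; first by rewrite muln0 addn0.
  by rewrite tS mulnS; have := sk (t m); lia.
have t_gt m : (m <= eta)%N -> (k < t m)%N.
  move=> m_le; have := t_ge m; have : (k * m <= k * eta)%N by rewrite leq_mul2l m_le orbT.
  by rewrite mulnS in hn; lia.
have t_sum a d : (a + d <= eta.+1)%N ->
    t a = (t (a + d) + \sum_(a <= m < a + d) s (t m))%N.
  elim: d => [|d IH] had; first by rewrite addn0 big_geq // addn0.
  rewrite addnS in had *; rewrite big_nat_recr ?leq_addr //= IH ?tS; last exact: ltnW.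
  by have := sk (t (a + d)%N); have := t_gt (a + d)%N had; lia.
have X_iter a d : (a + d <= eta.+1)%N -> X (t a) <= iter d f (X (t (a + d)%N)).
  elim: d => [|d IH] had; first by rewrite addn0.
  rewrite addnS in had *; apply: le_trans (IH (ltnW had)) _.
  rewrite iterSr tS; apply: iter_homo_le => //; apply: step; exact: t_gt.
have [N1 [N2 [+ /andP[_ N2e]]]] := path n.
(* The [m]-th summand is the step leaving [t m.-1]; after shifting [N1] down by one, the sum
   telescopes to [t N1 - t N2]. *)
case: N1 => // N1 /= N1e inJ.
(* An empty sum would be 0, which is not in [J]. *)
have N12 : (N1 < N2)%N.
  by rewrite ltnNge; apply/negP => le21; have := Jpos _ inJ; rewrite big_geq.
have sumE : (\sum_(N1.+1 <= m < N2.+1) s (iter m.-1 (fun t => t - s t) n) =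
             \sum_(N1 <= m < N2) s (t m))%N.
  by rewrite big_add1.
have XN1 : X (t N1) <= T.
  apply: (jump _ _ _ inJ); first by apply: t_gt; lia.
  have -> : (t N1 - \sum_(N1.+1 <= m < N2.+1) s (iter m.-1 (fun t => t - s t) n)
             = t N2)%N.
    rewrite sumE; have := t_sum N1 (N2 - N1)%N; rewrite subnKC ?(ltnW N12) // => -> //.
      by rewrite addnK.
    by lia.
  (* The path from [t N1.+1] to [t N2] costs fewer than [eta] applications of [f]; expansiveness
     rounds this up to exactly [eta], the form that [jump] expects. *)
  rewrite -tS; have := X_iter N1.+1 (N2 - N1.+1)%N.
  rewrite subnKC // => /(_ (leqW N2e)) /le_trans; apply.
  by apply: iter_expansive_le => //; lia.
have := X_iter 0%N N1; rewrite add0n => /(_ (leqW (ltnW N1e))) /le_trans; apply.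
apply: (le_trans (iter_homo_le N1 f_homo XN1)).
exact: iter_expansive_le (ltnW N1e).
Qed.

(** * Comparison of the two components, saturation of a quotient, and maximising lags *)

Lemma le_affine_of_comparison (R : realType) (M1 M2 M3 M4 u v : R) :
  0 < M1 -> M1 * v + M2 <= M3 * u + M4 ->
  v <= M3 / M1 * u + (M4 - M2) / M1.
Proof. by move=> M1_gt0 h; rewrite mulrAC -mulrDl ler_pdivlMr //; lra. Qed.

Lemma saturation_bound (R : realType) (A P Q M1 M2 eB eC : R) :
  0 < A -> 0 <= P -> 0 <= Q -> 0 < M1 -> 0 <= M2 -> 0 < eB -> 0 < eC ->
  exists2 T, 0 <= T & forall b c z w : R,
    0 <= b -> 0 <= c -> 0 <= z -> 0 <= w -> z <= M1 * w + M2 ->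
    eB <= b \/ eC <= c ->
    A * (P + Q * z) <= T * (A + b * z + c * w).
Proof.
move=> A0 P0 Q0 M10 M20 eB0 eC0.
have AQ0 : 0 <= A * Q by rewrite mulr_ge0 // ltW.
have QM20 : 0 <= Q * M2 by rewrite mulr_ge0.
have TB0 : 0 <= A * Q / eB by rewrite mulr_ge0 // invr_ge0 ltW.
have TC0 : 0 <= A * Q * M1 / eC.
  by rewrite mulr_ge0 ?invr_ge0 ?(ltW eC0) // mulr_ge0 // ltW.
(* [T * A] absorbs the constants [A * (P + Q * M2)]. The linear part [A * Q * z] is absorbed by
   [T * b * z] when [eB <= b], and by [T * c * w] when [eC <= c], after replacing [z] by
   [M1 * w + M2]. *)
pose T := P + Q * M2 + A * Q / eB + A * Q * M1 / eC.
have : A * Q * M1 / eC <= T by rewrite /T; lra.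
have : A * Q / eB <= T by rewrite /T; lra.
have : P + Q * M2 <= T by rewrite /T; lra.
have : 0 <= T by rewrite /T; lra.
move: T => T T0 TP TB TC; exists T => // b c z w b0 c0 z0 w0 zw ebc.
have TA : A * (P + Q * M2) <= A * T by rewrite ler_pM2l.
have AQM2 : 0 <= A * (Q * M2) by rewrite mulr_ge0 // ltW.
have Tbz : 0 <= T * (b * z) by rewrite !mulr_ge0.
have Tcw : 0 <= T * (c * w) by rewrite !mulr_ge0.
case: ebc => [eb|ec].
  have : A * Q * z <= T * (b * z).
    rewrite mulrA ler_wpM2r //; apply: le_trans (_ : A * Q / eB * eB <= _).
      by rewrite divfK // gt_eqF.
    by rewrite ler_pM // ltW.
  lra.
have : A * Q * M1 * w <= T * (c * w).
  rewrite mulrA ler_wpM2r //; apply: le_trans (_ : A * Q * M1 / eC * eC <= _).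
    by rewrite divfK // gt_eqF.
  by rewrite ler_pM // ltW.
have : A * Q * z <= A * Q * (M1 * w + M2) by rewrite ler_wpM2l.
lra.
Qed.

(** Turns the choice of a maximising lag into a function of the time [n], so that the backward path
    is a plain iteration. *)
Lemma argmax_selector (R : realType) (k : nat) (P : pred nat) (i0 : nat)
    (g : nat -> nat -> R) :
  P i0 -> (forall i, P i -> (i <= k)%N) ->
  exists s : nat -> nat, forall n,
    P (s n) /\ forall i, P i -> g n i <= g n (s n).
Proof.
move=> Pi0 Pk; have i0k : P (@inord k i0) by rewrite inordK // ltnS Pk.
exists (fun n => val [arg max_(i > @inord k i0 | P i) g n i]%O) => n.
case: arg_maxP => // i Pi gi; split=> // j Pj.
have jk : (j < k.+1)%N by rewrite ltnS Pk.
exact: (gi (Ordinal jk)).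
Qed.

(** * The uniform eventual bound for solutions *)

Theorem theorem20 (R : realType) (k : nat) (hk : (1 <= k)%N)
    (alpha : R) (beta gamma : nat -> R) (A : R) (B C : nat -> R)
    (p : R) (delta epsilon : nat -> R) (q : R) (D E : nat -> R)
    (halpha : 0 <= alpha) (hbeta : nonneg_coeffs k beta)
    (hgamma : nonneg_coeffs k gamma)
    (hA : 0 <= A) (hB : nonneg_coeffs k B) (hC : nonneg_coeffs k C)
    (hp : 0 <= p) (hdelta : nonneg_coeffs k delta)
    (hepsilon : nonneg_coeffs k epsilon)
    (hq : 0 <= q) (hD : nonneg_coeffs k D) (hE : nonneg_coeffs k E)
    (hcomp : exists M1 M2 M3 M4 : R,
       [/\ 0 < M1, 0 < M3, 0 <= M2, M2 <= M4
         & forall x y : int -> R,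
             is_solution k alpha beta gamma A B C p delta epsilon q D E x y ->
             forall n : nat, (1 <= n)%N ->
               x n%:Z <= M1 * y n%:Z + M2 /\
               M1 * y n%:Z + M2 <= M3 * x n%:Z + M4])
    (hApos : 0 < A)
    (heta : exists eta : nat, (1 <= eta)%N /\
       forall c : nat -> nat,
         (forall m : nat, (1 <= m)%N ->
            c m \in [predU pos_index k beta & pos_index k gamma]) ->
         exists N1 N2 : nat,
           [/\ (1 <= N1 <= eta)%N, (1 <= N2 <= eta)%N
             & (\sum_(N1 <= m < N2.+1) c m)%N
                 \in [predU pos_index k B & pos_index k C]]) :
  exists (M : R) (N : nat),
    [/\ 0 < M, (1 <= N)%N
      & forall x y : int -> R,
          is_solution k alpha beta gamma A B C p delta epsilon q D E x y ->
          forall n : nat, (N < n)%N -> x n%:Z <= M /\ y n%:Z <= M].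
Proof.
have [M1 [M2 [M3 [M4 [M1_gt0 M3_gt0 M2_ge0 M24 cmp]]]]] := hcomp.
have [eta [_ path]] := heta.
set I := [predU pos_index k beta & pos_index k gamma] in path.
set J := [predU pos_index k B & pos_index k C] in path.
have I_bounds i : i \in I -> (1 <= i <= k)%N.
  by rewrite !inE => /orP[] /andP[].
have J_bounds j : j \in J -> (1 <= j <= k)%N.
  by rewrite !inE => /orP[] /andP[].
have [s [r [s_ge0 r_ge0 cmp_y]]] : exists s r : R, [/\ 0 <= s, 0 <= r
    & forall u v, M1 * v + M2 <= M3 * u + M4 -> v <= s * u + r].
  exists (M3 / M1), ((M4 - M2) / M1).
  split=> [||u v]; last exact: le_affine_of_comparison.
    by rewrite divr_ge0 ?ltW.
  by rewrite divr_ge0 ?subr_ge0 // ltW.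
have sum_ge0 (d : nat -> R) : nonneg_coeffs k d -> 0 <= \sum_(1 <= i < k.+1) d i.
  move=> d0; rewrite big_seq sumr_ge0 // => i.
  by rewrite mem_index_iota ltnS => /d0.
have [K KE] : exists K, K = alpha + r * \sum_(1 <= i < k.+1) gamma i by eexists.
have [L LE] : exists L, L = \sum_(1 <= i < k.+1) beta i
    + s * \sum_(1 <= i < k.+1) gamma i by eexists.
have K_ge0 : 0 <= K by rewrite KE; apply: addr_ge0 => //; apply: mulr_ge0 => //; exact: sum_ge0.
have L_ge0 : 0 <= L by rewrite LE; apply: addr_ge0; [|apply: mulr_ge0 => //]; exact: sum_ge0.
(* The numerator bound [K + L * u] over the denominator bound [A] gives slope [L / A]; the extra 1
   makes [f] expansive on non-negative arguments. *)
pose f u := K / A + (L / A + 1) * u.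
have KA_ge0 : 0 <= K / A by rewrite divr_ge0.
have LA_ge0 : 0 <= L / A by rewrite divr_ge0.
have f_homo : {homo f : u v / u <= v}.
  by move=> u v uv; rewrite lerD2l ler_wpM2l // addr_ge0.
have f_exp u : 0 <= u -> u <= f u.
  by move=> u0; have := mulr_ge0 LA_ge0 u0; rewrite /f (mulrDl (L / A)); lra.
have Af u : A * f u = K + L * u + A * u.
  by rewrite /f; field; rewrite gt_eqF.
(* One application of [f] bounds the numerator at the current time, and [eta] more reach the later
   point of the path; the composite stays affine. *)
have [P [Q [P_ge0 Q_ge0 fPQ]]] :=
  iter_affine eta.+1 KA_ge0 (addr_ge0 LA_ge0 (@ler01 R)).
have [eB eB_gt0 eBP] := pos_index_lower_bound k B.
have [eC eC_gt0 eCP] := pos_index_lower_bound k C.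
have [T T_ge0 satT] :=
  saturation_bound hApos P_ge0 Q_ge0 M1_gt0 M2_ge0 eB_gt0 eC_gt0.
have fT_ge0 : 0 <= iter eta f T.
  exact: le_trans (iter_expansive_le f_exp T_ge0 (leq0n eta)).
(* [V] covers two cases: [iter eta f T] when [I] is non-empty and [K / A] when it is empty. *)
have [V [V_ge0 fV KV]] : exists V, [/\ 0 <= V, iter eta f T <= V & K / A <= V].
  by exists (iter eta f T + K / A); split; lra.
exists (V + s * V + r + 1), (k * eta.+1)%N; split.
- by have := mulr_ge0 s_ge0 V_ge0; lra.
- by rewrite muln_gt0 hk.
move=> x y sol n hn.
have nonneg := solution_ge0 hk halpha hbeta hgamma hp hdelta hepsilon sol.
have hist m i : (1 <= i <= k)%N -> (0 < m)%N ->
    0 <= x (m%:Z - i%:Z) /\ 0 <= y (m%:Z - i%:Z).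
  by move=> ik m0; apply: nonneg; move: ik m0; clear; lia.
have x_ge0 m : 0 <= x m%:Z by apply: (nonneg _ _).1; move: hk; clear; lia.
have y_ge0 m : 0 <= y m%:Z by apply: (nonneg _ _).2; move: hk; clear; lia.
have y_le m : (1 <= m)%N -> y m%:Z <= s * x m%:Z + r.
  by move=> /(cmp _ _ sol)[_ /cmp_y].
have natB m i : (k < m)%N -> (i <= k)%N -> m%:Z - i%:Z = (m - i)%N%:Z.
  by move=> km ik; rewrite subzn // ltnW // (leq_ltn_trans ik).
have num_le m z : (k < m)%N -> 0 <= z ->
    (forall i, i \in I -> x (m - i)%N%:Z <= z) ->
    affine_form k alpha beta gamma x y m <= K + L * z.
  move=> km z0 hz; rewrite KE LE; apply: affine_form_le => // i ik.
    have [_ i_le_k] := andP ik; rewrite natB // y_le // subn_gt0.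
    exact: leq_ltn_trans km.
  by rewrite natB ?hz //; case/andP: (I_bounds _ ik).
have den_ge m j : (k < m)%N -> (1 <= j <= k)%N ->
    A + B j * x (m - j)%N%:Z + C j * y (m - j)%N%:Z <= affine_form k A B C x y m.
  move=> km jk; rewrite -natB //; last by case/andP: jk.
  by apply: affine_form_ge_term => // i ik; apply: hist => //; exact: leq_ltn_trans km.
have den_geA m : (k < m)%N -> A <= affine_form k A B C x y m.
  move=> km; have k1 : (1 <= 1 <= k)%N by rewrite hk.
  apply: le_trans (den_ge _ _ km k1); rewrite -addrA lerDl.
  by rewrite addr_ge0 // mulr_ge0 ?hB ?hC.
have x_le_num m z : (k < m)%N -> 0 <= z ->
    affine_form k alpha beta gamma x y m <= z -> x m%:Z <= z / A.
  move=> km z0 hz; have [d _ -> _] := sol.2 m (leq_ltn_trans (leq0n k) km).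
  rewrite ler_pdivrMr // (le_trans hz) // mulrAC ler_pdivlMr // ler_wpM2l //.
  exact: den_geA.
have kn : (k < n)%N by apply: leq_ltn_trans hn; rewrite leq_pmulr.
suff xV : x n%:Z <= V.
  have sx : s * x n%:Z <= s * V by rewrite ler_wpM2l.
  have yn := y_le n (leq_ltn_trans (leq0n k) kn).
  have sV : 0 <= s * V by rewrite mulr_ge0.
  by split; lra.
(* If [I] is empty, there is no lag to follow backwards; then the numerator is at most [K] and
   [x n <= K / A] at once. *)
have [/hasP[i0 _ Ii0]|noI] := boolP (has (mem I) (iota 1 k)); last first.
  apply: le_trans KV; apply: x_le_num => //; have := num_le n 0 kn (lexx 0).
  rewrite mulr0 addr0; apply=> i Ii; case/hasP: noI.
  by exists i; rewrite // mem_iota add1n ltnS I_bounds.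
have I_le i : i \in I -> (i <= k)%N by move=> /I_bounds/andP[].
have [c cP] := argmax_selector (fun m i => x (m - i)%N%:Z) Ii0 I_le.
have c_le m : (c m <= k)%N by apply: I_le; exact: (cP m).1.
have num_le_f m : (k < m)%N ->
    affine_form k alpha beta gamma x y m <= A * f (x (m - c m)%N%:Z).
  move=> km; apply: le_trans (num_le m _ km (x_ge0 _) (cP m).2) _.
  by rewrite Af lerDl mulr_ge0 // ltW.
apply: le_trans fV.
apply: (@descent_path_bound R k eta J f T (fun m => x m%:Z) c) => //.
- by move=> j /J_bounds/andP[].
- move=> m km; have := x_le_num m (A * f (x (m - c m)%N%:Z)) km.
  rewrite mulrAC divff ?gt_eqF // mul1r; apply; last exact: num_le_f.
  by rewrite mulr_ge0 // (le_trans (x_ge0 (m - c m)%N)) // f_exp.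
- move=> m j km jJ hx; have jk := J_bounds _ jJ.
  set z := x (m - j)%N%:Z in hx; set w := y (m - j)%N%:Z.
  have z0 : 0 <= z by exact: x_ge0.
  have w0 : 0 <= w by exact: y_ge0.
  have zw : z <= M1 * w + M2.
    have [] // := cmp _ _ sol (m - j)%N; rewrite subn_gt0.
    by case/andP: jk => _ j_le_k; exact: leq_ltn_trans km.
  (* Monotonicity of [f] applied to [hx] expresses the numerator through the same [z] that occurs in
     the denominator at lag [j]. *)
  have num : affine_form k alpha beta gamma x y m <= A * (P + Q * z).
    apply: le_trans (num_le_f m km) _.
    by rewrite ler_pM2l // -fPQ iterS; apply: f_homo.
  have [d _ -> _] := sol.2 m (leq_ltn_trans (leq0n k) km).
  rewrite ler_pdivrMr //; apply: le_trans num _.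
  apply: le_trans (ler_wpM2l T_ge0 (den_ge m j km jk)).
  apply: satT; rewrite ?hB ?hC //.
  by move: jJ; rewrite inE => /orP[/eBP|/eCP]; [left|right].
(* The index hypothesis is applied to the successive maximising lags met on the path from [m],
   numbered from 1. *)
- move=> m; apply: (path (fun l => c (iter l.-1 (fun t => t - c t)%N m))).
  by move=> l _; exact: (cP _).1.
Qed.
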